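(* Let $0<\alpha$, $0<\beta$ with $\alpha+\beta\le\tfrac12$ and $p_1\in[0,1]$, and put $\delta=\frac{1}{1-\alpha p_1}$, $t_1=\delta\tau_0$ (the duration of the first epoch under the attack). Under the Pay-Per-Share (PPS) scheme with variable share difficulty (vardiff), with $2^{-Z}$ the ratio of the adversary's share difficulty to the block difficulty in the first epoch, if the adversary conducts a classical block withholding (BWH) attack against a victim pool with fraction $p_1$ of its power from $t=0$ onwards, then after the first epoch, for all $x\ge0$, the revenue changes of the adversary, of the honest members of the victim pool and of the remaining honest miners are $$\Delta_A(t_1+x)=\frac{\alpha x}{\tau_0}\big(\delta(1-p_1\delta 2^{-Z})-1\big)-\alpha\delta p_12^{-Z}$$ (which is $\approx\frac{\alpha x}{\tau_0}(\delta-1)$ when terms proportional to $2^{-Z}\ll1$ are neglected), $$\Delta_{H_P}(t_1+x)=\frac{\beta x}{\tau_0}(\delta-1),\qquad \Delta_{H_R}(t_1+x)=\frac{(1-\alpha-\beta)x}{\tau_0}(\delta-1),$$ whereas the revenue change of the pool operator is $$\Delta_{Po}(t_1+x)=-\delta\alpha p_1(1-2^{-Z})-\frac{\alpha x}{\tau_0}\,\delta p_1(1-\delta2^{-Z}).$$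
   Context: Model (all revenues, rates and epoch durations are expected values and are treated deterministically). The total network hashpower is normalized to $1$. The adversary ($A$) controls a fraction $\alpha$; the honest members of a victim pool ($H_P$) control $\beta$; the remaining honest miners ($H_R$) control $1-\alpha-\beta$. An epoch is the time needed to accumulate $D_0$ blocks on the chain; each block has coinbase reward $R_b=1/D_0$, so the total coinbase reward of an epoch is $1$. There are no forks: every published block is on the chain. At relative block difficulty $d$ (with $d=1$ for the epoch starting at $t=0$), hashpower $h$ finds full proofs-of-work (valid blocks, fPoW) at rate $hD_0/(d\tau_0)$, where $\tau_0$ is the target epoch duration; thus if everyone mines honestly at $d=1$, an epoch lasts $\tau_0$. At the end of an epoch of actual duration $\tau$, the difficulty is multiplied by $\tau_0/\tau$ (difficulty adjustment). PPS pool with vardiff: each miner's share difficulty is set by the pool so that the miner finds shares at a fixed target rate, and it does not change when the block difficulty changes (the miner's pool hashpower being constant). For the adversary's pool hashpower $\alpha p_1$, the ratio of share difficulty to block difficulty, equivalently the probability that a share is an fPoW, is $2^{-Z}$ in the first epoch ($d=1$) and $2^{-Z}/d$ at relative block difficulty $d$. The pool operator ($Po$) immediately pays $R_b\cdot\frac{\text{share difficulty}}{\text{block difficulty}}$ for every submitted share (whether or not it is an fPoW) and collects the coinbase reward of every block submitted to the pool. Pool fees are neglected. Attack: before $t=0$ everyone mines honestly. From $t=0$ on, the adversary uses hashpower $\alpha p_1$ in the victim pool, submitting all shares that are not fPoWs and never submitting (discarding, and not being paid for) any fPoW; it uses hashpower $\alpha(1-p_1)$ for honest solo mining, keeping the coinbase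 rewards. Honest pool members submit all their shares, including fPoWs; the remaining honest miners keep the coinbase rewards of the blocks they find. Revenue change: for each entity $x$, $\Delta_x(t)$ is its total revenue over $[0,t]$ under the attack minus its total revenue over $[0,t]$ without attack. Without attack, a mining entity with hashpower fraction $f_x$ earns $f_x t/\tau_0$ and the pool operator has net revenue $0$. The operator's revenue is coinbase rewards collected minus PPS payments made. *)

(* Defs.v *)
From mathcomp Require Import all_boot all_order all_algebra.
From mathcomp Require Import all_classical all_reals all_analysis.
Import Order.TTheory GRing.Theory Num.Theory.
Import numFieldNormedType.Exports.
Set Implicit Arguments.
Unset Strict Implicit.
Unset Printing Implicit Defensive.
Local Open Scope ring_scope.
Local Open Scope classical_set_scope.

Section Model.
Context {R : realType}.
Variables (D0 : nat) (tau0 : R).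

Definition coinbase : R := D0%:R^-1.

(* Rate at which hashpower h finds solutions of difficulty d. Every difficulty
   is relative to the block difficulty of the epoch starting at time 0. The
   formula is used for blocks (full proofs-of-work) and for shares alike, as
   shares are solutions of the same puzzle at the share difficulty. *)
Definition find_rate (h d : R) : R := h * D0%:R / (d * tau0).

(* Share-to-block difficulty ratio, which is also the probability that a share
   is a full proof-of-work. *)
Definition share_ratio (s d : R) : R := s / d.

Definition share_payment (s d : R) : R := coinbase * share_ratio s d.

Variables (alpha beta p1 : R).

(* The blocks found by the adversary inside the pool are discarded: only the
   solo-mining part of the adversary's hashpower extends the chain. *)
Definition chain_rate (d : R) : R :=
  find_rate (alpha * (1 - p1)) d + find_rate beta d
  + find_rate (1 - alpha - beta) d.

Definition epoch_duration (d : R) : R := D0%:R / chain_rate d.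

Fixpoint difficulty (k : nat) : R :=
  if k is j.+1 then
    difficulty j * (tau0 / epoch_duration (difficulty j))
  else 1.

Definition epoch_start (k : nat) : R :=
  \sum_(j < k) epoch_duration (difficulty j).

Definition time_in_epoch (k : nat) (t : R) : R :=
  Num.max 0 (Num.min t (epoch_start k.+1) - epoch_start k).

(* Revenue over [0, t] of an entity that earns rate d per unit of time while
   the block difficulty is d. *)
Definition revenue (rate : R -> R) (t : R) : R :=
  limn (series (fun k => rate (difficulty k) * time_in_epoch k t)).

Definition revenue_change (rate : R -> R) (f t : R) : R :=
  revenue rate t - f * t / tau0.

Definition solo_rate (h d : R) : R := find_rate h d * coinbase.

(* With vardiff, a miner of constant hashpower h has a share difficulty s that
   does not depend on the block difficulty d, hence a constant share rate
   find_rate h s. *)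
Definition honest_pay_rate (h s d : R) : R :=
  find_rate h s * share_payment s d.

Definition withholding_pay_rate (h s d : R) : R :=
  find_rate h s * (1 - share_ratio s d) * share_payment s d.

Definition adversary_share_difficulty (Z : R) : R := 2 `^ (- Z).

Definition adversary_pay_rate (Z d : R) : R :=
  withholding_pay_rate (alpha * p1) (adversary_share_difficulty Z) d.

(* The honest members of the pool have hashpowers h i and share
   difficulties s i, for i < n. *)
Definition members_pay_rate (n : nat) (h s : 'I_n -> R) (d : R) : R :=
  \sum_(i < n) honest_pay_rate (h i) (s i) d.

Definition Delta_A (Z : R) : R -> R :=
  revenue_change
    (fun d => solo_rate (alpha * (1 - p1)) d + adversary_pay_rate Z d) alpha.

Definition Delta_HP (n : nat) (h s : 'I_n -> R) : R -> R :=
  revenue_change (members_pay_rate h s) beta.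

Definition Delta_HR : R -> R :=
  revenue_change (solo_rate (1 - alpha - beta)) (1 - alpha - beta).

(* Without attack the operator's net revenue is 0. *)
Definition Delta_Po (Z : R) (n : nat) (h s : 'I_n -> R) : R -> R :=
  revenue_change
    (fun d => find_rate beta d * coinbase
              - (members_pay_rate h s d + adversary_pay_rate Z d)) 0.

End Model.

(* Main.v *)
(** After the first epoch, of duration [delta * tau0], the difficulty is
    multiplied by [1 - alpha * p1], which is exactly the share of hashpower still
    extending the chain: every later epoch lasts [tau0] and the difficulty stays
    constant. Hence an entity earning [rate d] per unit of time at difficulty [d]
    has revenue [rate 1 * t1 + rate (1 - alpha * p1) * x] at time [t1 + x]. *)
Require Import Defs.
From mathcomp Require Import all_boot all_order all_algebra.
From mathcomp Require Import all_classical all_reals all_analysis.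
From mathcomp Require Import ring lra.
Import Order.TTheory GRing.Theory Num.Theory.
Import numFieldNormedType.Exports.
Local Open Scope ring_scope.

Section Epochs.
Context {R : realType}.
Variables (D0 : nat) (tau0 alpha beta p1 : R).
Hypotheses (D0_gt0 : (0 < D0)%N) (tau0_gt0 : 0 < tau0).
Hypothesis chain_power_gt0 : 0 < 1 - alpha * p1.

Local Notation a := (1 - alpha * p1).
Local Notation duration := (epoch_duration D0 tau0 alpha beta p1).
Local Notation difficulty := (difficulty D0 tau0 alpha beta p1).
Local Notation epoch_start := (epoch_start D0 tau0 alpha beta p1).
Local Notation time_in_epoch := (time_in_epoch D0 tau0 alpha beta p1).

Let D0_neq0 : D0%:R != 0 :> R. Proof. by rewrite pnatr_eq0 -lt0n. Qed.
Let tau0_neq0 : tau0 != 0. Proof. exact: lt0r_neq0. Qed.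
Let a_neq0 : a != 0. Proof. exact: lt0r_neq0. Qed.

Lemma epoch_durationE (d : R) : d != 0 -> duration d = d * tau0 / a.
Proof.
move=> d0; rewrite /epoch_duration.
have -> : chain_rate D0 tau0 alpha beta p1 d = a * D0%:R / (d * tau0).
  by rewrite /chain_rate /find_rate; field; rewrite d0 tau0_neq0.
by field; rewrite a_neq0 D0_neq0 tau0_neq0 d0.
Qed.

(** An epoch's duration is proportional to its difficulty [d], so the adjusted value
    [d * (tau0 / duration d)] is [a] for every nonzero [d]: a single adjustment suffices. *)
Lemma difficultyS k : difficulty k.+1 = a.
Proof.
elim: k => [|k IHk].
  rewrite /= epoch_durationE ?oner_neq0 //.
  by field; rewrite a_neq0 tau0_neq0.
rewrite -[LHS]/(difficulty k.+1 * (tau0 / duration (difficulty k.+1))).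
by rewrite IHk epoch_durationE //; field; rewrite a_neq0 tau0_neq0.
Qed.

Lemma epoch_startS k : epoch_start k.+1 = a^-1 * tau0 + tau0 *+ k.
Proof.
rewrite /epoch_start big_ord_recl -[difficulty ord0]/1.
rewrite epoch_durationE ?oner_neq0 // mul1r [tau0 / a]mulrC; congr (_ + _).
rewrite (eq_bigr (fun=> tau0)) ?sumr_const ?card_ord // => i _.
by rewrite lift0 difficultyS epoch_durationE //; field.
Qed.

Lemma epoch_start0 : epoch_start 0 = 0.
Proof. by rewrite /epoch_start big_ord0. Qed.

Lemma time_in_first_epoch (x : R) : 0 <= x ->
  time_in_epoch 0 (a^-1 * tau0 + x) = a^-1 * tau0.
Proof.
move=> x_ge0; rewrite /time_in_epoch epoch_start0 epoch_startS mulr0n addr0 subr0.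
by rewrite min_r ?lerDl // max_r // mulr_ge0 ?invr_ge0 ?ltW.
Qed.

(** The later epochs follow each other without gaps, so their portions before the cutoff telescope;
    once [tau0 *+ n] reaches [x], the sum is [x]. *)
Lemma sum_time_in_later_epochs (x : R) n : 0 <= x ->
  \sum_(k < n) time_in_epoch k.+1 (a^-1 * tau0 + x) = Num.min x (tau0 *+ n).
Proof.
move=> x_ge0; elim: n => [|n IHn]; first by rewrite big_ord0 mulr0n min_r.
rewrite big_ord_recr /= IHn /time_in_epoch !epoch_startS -addr_minr mulrSr.
have n_ge0 : 0 <= tau0 *+ n by rewrite mulrn_wge0 ?ltW.
(* Up to the common offset [a^-1 * tau0], the identity left is [min x y + max 0 (min x (y + tau0) -
   y) = min x (y + tau0)]. *)
move: (tau0 *+ n) n_ge0 => y y_ge0.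
have tau0_pos := tau0_gt0.
case: (leP x y) => ?; case: (leP x (y + tau0)) => ?;
  rewrite /Num.max; case: ifP => ?; lra.
Qed.

(** Finitely many epochs cover any bounded time, so the partial sums of the series are eventually
    constant and the limit is their common value. *)
Lemma revenueE (rate : R -> R) (x : R) : 0 <= x ->
  revenue D0 tau0 alpha beta p1 rate (a^-1 * tau0 + x)
    = rate 1 * (a^-1 * tau0) + rate a * x.
Proof.
move=> x_ge0; rewrite /revenue.
have [N xN] : exists N, x <= tau0 *+ N.
  exists (Num.bound (x / tau0)).
  rewrite -mulr_natl -ler_pdivrMr //.
  exact/ltW/archi_boundP/divr_ge0/ltW.
apply/cvg_lim => //; apply: cvg_near_cst.
(* One term for the first epoch, then at least [N] later ones, which cover [x]. *)
exists N.+1 => // -[//|k] /= Nk.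
rewrite /series [LHS]big_mkord big_ord_recl time_in_first_epoch //.
congr (_ + _).
under eq_bigr => i _ do rewrite lift0 difficultyS.
rewrite -mulr_sumr sum_time_in_later_epochs // min_l //.
by rewrite (le_trans xN) // ler_pMn2l.
Qed.

Lemma solo_rateE (h d : R) : d != 0 ->
  solo_rate D0 tau0 h d = h / (d * tau0).
Proof.
by move=> d0; rewrite /solo_rate /find_rate /coinbase; field;
  rewrite D0_neq0 tau0_neq0 d0.
Qed.

(** The share rate is inversely proportional to [s] and the payment per share proportional to it;
    only the withheld fraction [s / d] keeps a trace of [s]. *)
Lemma withholding_pay_rateE (h s d : R) : s != 0 -> d != 0 ->
  withholding_pay_rate D0 tau0 h s d = h * (1 - s / d) / (d * tau0).
Proof.
move=> s0 d0.
rewrite /withholding_pay_rate /share_payment /find_rate /share_ratio /coinbase.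
by field; rewrite D0_neq0 tau0_neq0 d0 s0.
Qed.

(** The same cancellation, with nothing withheld, removes every [s i], so that only the total
    hashpower counts. *)
Lemma members_pay_rateE (n : nat) (h s : 'I_n -> R) (d : R) :
    (forall i, s i != 0) -> d != 0 ->
  members_pay_rate D0 tau0 h s d = (\sum_(i < n) h i) / (d * tau0).
Proof.
move=> s0 d0; rewrite /members_pay_rate mulr_suml; apply: eq_bigr => i _.
rewrite /honest_pay_rate /share_payment /find_rate /share_ratio /coinbase.
by field; rewrite D0_neq0 tau0_neq0 d0 s0.
Qed.

End Epochs.

Theorem corollary3 (R : realType) (D0 : nat) (tau0 alpha beta p1 : R)
    (n : nat) (h s : 'I_n -> R) :
  (0 < D0)%N -> 0 < tau0 ->
  0 < alpha -> 0 < beta -> alpha + beta <= 2^-1 ->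
  0 <= p1 <= 1 ->
  (forall i, 0 < h i) -> (forall i, 0 < s i) -> \sum_(i < n) h i = beta ->
  let delta := (1 - alpha * p1)^-1 in
  let t1 := delta * tau0 in
  epoch_duration D0 tau0 alpha beta p1 1 = t1 /\
  (forall Z x : R, 0 <= x ->
    [/\ Delta_A D0 tau0 alpha beta p1 Z (t1 + x)
          = alpha * x / tau0 * (delta * (1 - p1 * delta * 2 `^ (- Z)) - 1)
            - alpha * delta * p1 * 2 `^ (- Z),
        Delta_HP D0 tau0 alpha beta p1 h s (t1 + x)
          = beta * x / tau0 * (delta - 1),
        Delta_HR D0 tau0 alpha beta p1 (t1 + x)
          = (1 - alpha - beta) * x / tau0 * (delta - 1)
      & Delta_Po D0 tau0 alpha beta p1 Z h s (t1 + x)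
          = - (delta * alpha * p1 * (1 - 2 `^ (- Z)))
            - alpha * x / tau0 * (delta * p1 * (1 - delta * 2 `^ (- Z)))]) /\
  (forall x : R, 0 <= x -> exists C : R, forall Z : R,
    Delta_A D0 tau0 alpha beta p1 Z (t1 + x)
      = alpha * x / tau0 * (delta - 1) + C * 2 `^ (- Z)).
Proof.
move=> D0_gt0 tau0_gt0 alpha_gt0 beta_gt0 ab_le p1_01 _ s_gt0 sum_h delta t1.
(* Since [beta] is positive, [alpha < 1/2], and [p1 <= 1] gives [alpha * p1 < 1]. *)
have a_gt0 : 0 < 1 - alpha * p1 by case/andP: p1_01 => *; nra.
have a_neq0 := lt0r_neq0 a_gt0.
have tau0_neq0 := lt0r_neq0 tau0_gt0.
have s_neq0 i : s i != 0 by rewrite gt_eqF.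
have one_neq0 := oner_neq0 R.
have DeltaA Z x : 0 <= x -> Delta_A D0 tau0 alpha beta p1 Z (t1 + x)
    = alpha * x / tau0 * (delta * (1 - p1 * delta * 2 `^ (- Z)) - 1)
      - alpha * delta * p1 * 2 `^ (- Z).
  move=> x_ge0; rewrite /Delta_A /revenue_change /t1 /delta revenueE //.
  have Z_neq0 : (2 : R) `^ (- Z) != 0 by rewrite gt_eqF ?powR_gt0.
  rewrite /adversary_pay_rate !solo_rateE // !withholding_pay_rateE //.
  by rewrite /adversary_share_difficulty; field; rewrite a_neq0.
split; first by rewrite epoch_durationE // /t1 /delta mul1r mulrC.
split=> [Z x x_ge0|x x_ge0]; last first.
  (* The coefficient of [2 ^ (- Z)] in [DeltaA]: the first term stems from the later epochs, the
     second from the first epoch. *)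
  exists (- (alpha * x / tau0 * (p1 * delta ^+ 2)) - alpha * delta * p1) => Z.
  by rewrite DeltaA //; ring.
have Z_neq0 : (2 : R) `^ (- Z) != 0 by rewrite gt_eqF ?powR_gt0.
split; first exact: DeltaA.
- rewrite /Delta_HP /revenue_change /t1 /delta revenueE //.
  by rewrite !members_pay_rateE // sum_h; field; rewrite a_neq0.
- rewrite /Delta_HR /revenue_change /t1 /delta revenueE //.
  by rewrite !solo_rateE //; field; rewrite a_neq0.
- rewrite /Delta_Po /revenue_change /t1 /delta revenueE //.
  (* The coinbase collected equals solo income at hashpower [beta]. It cancels the members' pay, so
     the operator loses exactly what the adversary is paid. *)
  rewrite -!/(solo_rate D0 tau0 beta _) !solo_rateE // !members_pay_rateE // sum_h.
  rewrite /adversary_pay_rate !withholding_pay_rateE //.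
  by rewrite /adversary_share_difficulty; field; rewrite a_neq0.
Qed.
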